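(* Let $(X,\Sigma,\mu)$ be a complete $\sigma$-finite measure space and let $\mathcal{A}\subseteq\Sigma$ be a $\sigma$-subalgebra such that $(X,\mathcal{A},\mu|_{\mathcal{A}})$ is $\sigma$-finite. Let $1\le p,q<\infty$ and suppose that the measure space $(X,\mathcal{A},\mu|_{\mathcal{A}})$ is non-atomic. Then a weighted conditional expectation operator $T=M_wEM_u:L^p(\Sigma)\to L^q(\Sigma)$, $Tf=w\cdot E(uf)$, is nuclear if and only if $T=0$.
   Context: All statements about sets and functions are up to sets of measure zero; functions are complex-valued. $L^p(\Sigma)=L^p(X,\Sigma,\mu)$, and $L^0(\mu)$ is the space of measurable functions. $E=E^{\mathcal{A}}$ is the conditional expectation with respect to $\mathcal{A}$: $E(f)$ is the unique $\mathcal{A}$-measurable function with $\int_A E(f)\,d\mu=\int_A f\,d\mu$ for all $A\in\mathcal{A}$; it is defined for all measurable $f\ge 0$ (with values in $[0,\infty]$), for all $f\in L^p(\Sigma)$, and more generally for conditionable $f$, i.e. measurable $f$ with $E(|f|)<\infty$ a.e. (by linear extension). An $\mathcal{A}$-atom is a set $A\in\mathcal{A}$ with $\mu(A)>0$ such that every $F\in\mathcal{A}$ with $F\subseteq A$ has $\mu(F)=0$ or $\mu(F)=\mu(A)$. The space $(X,\mathcal{A},\mu|_{\mathcal{A}})$ is non-atomic if it has no $\mathcal{A}$-atoms. Weighted conditional expectation (WCE) operator: given $w,u\in L^0(\mu)$ such that $uf$ is conditionable for every $f\in L^p(\Sigma)$, $T=M_wEM_u$ is the linear map $T(f)=w\cdot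 E(uf)$; writing $T:L^p(\Sigma)\to L^q(\Sigma)$ means that $T$ maps $L^p(\Sigma)$ into $L^q(\Sigma)$. A bounded operator $T:Y\to Z$ between Banach spaces is nuclear if there are $(f_n)\subset Y^*$ and $(z_n)\subset Z$ with $\sum_{n=1}^\infty\|f_n\|\,\|z_n\|<\infty$ and $Ty=\sum_{n=1}^\infty f_n(y)z_n$ for all $y\in Y$. *)

(* Defs.v *)
From HB Require Import structures.
From mathcomp Require Import all_boot all_order all_algebra.
From mathcomp Require Import ring_quotient.
From mathcomp Require Import all_classical all_reals all_analysis.
From mathcomp Require Import measurable_realfun.
From mathcomp Require Import complex.

Set Implicit Arguments.
Unset Strict Implicit.
Unset Printing Implicit Defensive.

Import Order.TTheory GRing.Theory Num.Theory.
Import numFieldNormedType.Exports.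
Import Normc.

Local Open Scope classical_set_scope.
Local Open Scope ring_scope.
Local Open Scope complex_scope.
Local Open Scope quotient_scope.

Local Notation Re := complex.Re.
Local Notation Im := complex.Im.

Section complex_Lfun.
Context d (X : measurableType d) (R : realType).
Variable mu : {measure set X -> \bar R}.
Implicit Types f g : X -> R[i]^o.

(* Codomain [R[i]^o]: the complex numbers as a vector space over themselves. *)
Definition cmeasurable f :=
  measurable_fun [set: X] (fun x => Re (f x)) /\
  measurable_fun [set: X] (fun x => Im (f x)).

Definition cLnorm (p : R) f : \bar R :=
  'N[mu]_p%:E [EFin \o (fun x => normc (f x))]%E.

Lemma measurable_normc f : cmeasurable f ->
  measurable_fun [set: X] (fun x => normc (f x)).
Proof.
move=> [mr mi].
rewrite (_ : (fun x => _) =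
  (fun x => (Re (f x) ^+ 2 + Im (f x) ^+ 2) `^ 2^-1)); last first.
  apply/funext => x; rewrite powR12_sqrt ?addr_ge0 ?sqr_ge0//.
  by case: (f x).
apply: (measurableT_comp (measurable_powR _)).
by apply: measurable_funD; exact: measurable_funX.
Qed.

Lemma cmeasurable0 : cmeasurable 0.
Proof. by split; exact: measurable_cst. Qed.

Lemma cmeasurable_lin (a : R[i]) f g :
  cmeasurable f -> cmeasurable g -> cmeasurable (a *: f + g).
Proof.
move=> [fr fi] [gr gi]; split.
- rewrite (_ : (fun x => _) = (fun x =>
     Re a * Re (f x) - Im a * Im (f x) + Re (g x))); last first.
    apply/funext => x.
    rewrite -[_ x]/((a : R[i]) * f x + g x).
    by case: a (f x) (g x) => ? ? [? ?] [? ?].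
  by apply: measurable_funD => //; apply: measurable_funB;
    exact: measurable_funM.
- rewrite (_ : (fun x => _) = (fun x =>
     Re a * Im (f x) + Im a * Re (f x) + Im (g x))); last first.
    apply/funext => x.
    rewrite -[_ x]/((a : R[i]) * f x + g x).
    by case: a (f x) (g x) => ? ? [? ?] [? ?].
  by apply: measurable_funD => //; apply: measurable_funD;
    exact: measurable_funM.
Qed.

Section fixed_exponent.
Variables (p : R) (p1 : 1 <= p).

Let p0 : 0 < p. Proof. exact: lt_le_trans p1. Qed.

Lemma cLnorm_ge0 f : (0 <= cLnorm p f)%E.
Proof. exact: Lnorm_ge0. Qed.

Lemma le_Lnorm_EFin (h k : X -> R) :
  measurable_fun [set: X] h -> measurable_fun [set: X] k ->
  (forall x, 0 <= h x <= k x) ->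
  ('N[mu]_p%:E [EFin \o h] <= 'N[mu]_p%:E [EFin \o k])%E.
Proof.
move=> mh mk hk; rewrite unlock.
have m (l : X -> R) : measurable_fun [set: X] l ->
    measurable_fun [set: X] (fun x => `|(EFin \o l) x| `^ p)%E.
  move=> ml; apply: (measurableT_comp (measurable_poweR _)).
  by apply: measurableT_comp => //; exact/measurable_EFinP.
apply: gt0_ler_poweR.
- by rewrite invr_ge0 ltW.
- by rewrite in_itv/= leey andbT; apply: integral_ge0 => x _; rewrite lee_fin powR_ge0.
- by rewrite in_itv/= leey andbT; apply: integral_ge0 => x _; rewrite lee_fin powR_ge0.
- apply: ge0_le_integral => //; try exact: m.
  + by move=> x _; exact: poweR_ge0.
  + move=> x _ /=; case/andP: (hk x) => h0 hkx.
    rewrite lee_fin ge0_ler_powR ?nnegrE ?normr_ge0 ?(ltW p0)//.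
    by rewrite !ger0_norm// (le_trans h0 hkx).
Qed.

Lemma cLnormD f g : cmeasurable f -> cmeasurable g ->
  (cLnorm p (f + g)%R <= cLnorm p f + cLnorm p g)%E.
Proof.
move=> mf mg.
have nf := measurable_normc mf; have ng := measurable_normc mg.
have mfg : cmeasurable (f + g).
  by rewrite -[f]scale1r; exact: cmeasurable_lin.
apply: le_trans (minkowski_EFin mu nf ng p1).
apply: le_Lnorm_EFin; [exact: measurable_normc|exact: measurable_funD|].
move=> x; apply/andP; split; first by case: (_ x) => ? ?; exact: sqrtr_ge0.
exact: le_normcD.
Qed.

Lemma cLnormZ (a : R[i]) f : cmeasurable f ->
  (cLnorm p (a *: f)%R = (normc a)%:E * cLnorm p f)%E.
Proof.
move=> mf; rewrite /cLnorm unlock.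
have nf := measurable_normc mf.
have na : 0 <= normc a by case: (a) => ? ?; exact: sqrtr_ge0.
transitivity ((\int[mu]_x ((normc a `^ p)%:E * (`|normc (f x)| `^ p)%:E)) `^ p^-1)%E.
  congr (_ `^ _)%E; apply: eq_integral => x _ /=.
  by rewrite -EFinM -powRM// normcM normrM (ger0_norm na).
rewrite ge0_integralZl//; last 2 first.
- apply/measurable_EFinP; apply: (measurableT_comp (measurable_powR _)).
  exact: measurableT_comp nf.
- by rewrite lee_fin powR_ge0.
rewrite poweRM; last 2 first.
- by rewrite lee_fin powR_ge0.
- by apply: integral_ge0 => x _; rewrite lee_fin powR_ge0.
by rewrite poweR_EFin -powRrM mulfV ?gt_eqF// powRr1.
Qed.

Lemma cLnorm0 : cLnorm p 0 = 0%E.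
Proof.
rewrite /cLnorm (_ : _ \o _ = cst 0%E) ?Lnorm0 ?gt_eqF//.
by apply/funext => x; congr EFin; exact: normc0.
Qed.

End fixed_exponent.
End complex_Lfun.

Section Lp_space.
Context d (X : measurableType d) (R : realType).
Variables (mu : {measure set X -> \bar R}) (p : R) (p1 : 1 <= p).

(* The unused argument [1 <= p] makes the closure instances below available. *)
Definition cLfun of 1 <= p : {pred X -> R[i]^o} :=
  mem [set f : X -> R[i]^o | cmeasurable f /\ (cLnorm mu p f < +oo)%E].

Lemma cLfunP f : reflect (cmeasurable f /\ (cLnorm mu p f < +oo)%E) (f \in cLfun p1).
Proof. by apply: (iffP idP); rewrite inE. Qed.

Lemma cLfun_submod_closed : submod_closed (cLfun p1).
Proof.
split.
  by apply/cLfunP; split; [exact: cmeasurable0|rewrite cLnorm0].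
move=> a f g /cLfunP[mf lf] /cLfunP[mg lg]; apply/cLfunP; split.
  exact: cmeasurable_lin.
have maf : cmeasurable (a *: f).
  by rewrite -[_ *: _]addr0; exact: cmeasurable_lin mf (cmeasurable0 _ _).
apply: (le_lt_trans (cLnormD mu p1 maf mg)).
apply: lte_add_pinfty => //; rewrite (cLnormZ mu p1)//.
by apply: lte_mul_pinfty => //; rewrite lee_fin; case: (a) => ? ?; exact: sqrtr_ge0.
Qed.

HB.instance Definition _ :=
  GRing.isSubmodClosed.Build _ _ (cLfun p1) cLfun_submod_closed.

Definition cLfunType := {f : X -> R[i]^o | f \in cLfun p1}.

HB.instance Definition _ := SubChoice.on cLfunType.
HB.instance Definition _ := [SubChoice_isSubLmodule of cLfunType by <:].

Definition cae0 : {pred cLfunType} :=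
  mem [set f : cLfunType | {ae mu, forall x, val f x = 0}].

Lemma cae0P f : reflect {ae mu, forall x, val f x = 0} (f \in cae0).
Proof. by apply: (iffP idP); rewrite inE. Qed.

Lemma cae0_submod_closed : submod_closed cae0.
Proof.
split; first by apply/cae0P; apply: nearW.
move=> a f g /cae0P f0 /cae0P g0; apply/cae0P.
apply: filterS2 f0 g0 => x fx gx.
by rewrite linearP/= !fctE fx gx scaler0 addr0.
Qed.

HB.instance Definition _ := GRing.isSubmodClosed.Build _ _ cae0 cae0_submod_closed.

(* L^p functions modulo equality almost everywhere, see [cLp_classP]. *)
Definition cLp := Quotient.quot cae0.

HB.instance Definition _ := GRing.Zmodule.on cLp.
HB.instance Definition _ := EqQuotient.on cLp.


Definition cLp_class f (Lf : f \in cLfun p1) : cLp :=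
  \pi_cLp (Sub f Lf : cLfunType).

Lemma cLp_piP (f g : cLfunType) :
  reflect {ae mu, forall x, val f x = val g x} (\pi_cLp f == \pi_cLp g).
Proof.
rewrite -[_ == _]/(f == g %[mod Quotient.quot cae0]) -Quotient.idealrBE.
apply: (iffP (cae0P _)); rewrite linearB/=; apply: filterS => x;
  rewrite !fctE.
- by move/eqP; rewrite subr_eq0 => /eqP.
- by move=> ->; rewrite subrr.
Qed.

Lemma cLp_classP f g (Lf : f \in cLfun p1) (Lg : g \in cLfun p1) :
  cLp_class Lf = cLp_class Lg <-> {ae mu, forall x, f x = g x}.
Proof. by split => [/eqP/cLp_piP//|fg]; apply/eqP/cLp_piP. Qed.

Lemma cLp_piW (P : cLp -> Prop) :
  (forall f : cLfunType, P (\pi_cLp f)) -> forall F, P F.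
Proof. by move=> Ppi F; rewrite -[F]reprK. Qed.

Lemma cLp_classW (P : cLp -> Prop) :
  (forall f (Lf : f \in cLfun p1), P (cLp_class Lf)) -> forall F, P F.
Proof.
move=> PL; elim/cLp_piW => f; have := PL _ (valP f); rewrite /cLp_class.
by rewrite (_ : Sub _ _ = f)//; apply: val_inj; rewrite SubK.
Qed.

(* The scalar multiplication and the norm are defined through representatives;
   [cLp_scaleE] and [cLp_normE] show that the choice does not matter. *)
Definition cLp_scale (a : R[i]) (F : cLp) : cLp := \pi_cLp (a *: repr F).

Lemma cLp_scaleE a (f : cLfunType) : cLp_scale a (\pi_cLp f) = \pi_cLp (a *: f).
Proof.
apply/eqP/cLp_piP.
have /cLp_piP : \pi_cLp (repr (\pi_cLp f)) == \pi_cLp f by rewrite reprK.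
by apply: filterS => x; rewrite !linearZ/= !fctE => ->.
Qed.

Lemma cLp_addE (f g : cLfunType) : \pi_cLp (f + g) = \pi_cLp f + \pi_cLp g.
Proof. exact: raddfD. Qed.

Fact cLp_scalerA a b F : cLp_scale a (cLp_scale b F) = cLp_scale (a * b) F.
Proof. by elim/cLp_piW: F => f; rewrite !cLp_scaleE scalerA. Qed.

Fact cLp_scale1r : left_id 1 cLp_scale.
Proof. by elim/cLp_piW => f; rewrite cLp_scaleE scale1r. Qed.

Fact cLp_scalerDr : right_distributive cLp_scale +%R.
Proof.
move=> a F G; elim/cLp_piW: F => f; elim/cLp_piW: G => g.
by rewrite -cLp_addE !cLp_scaleE scalerDr cLp_addE.
Qed.

Fact cLp_scalerDl F : {morph cLp_scale^~ F : a b / a + b}.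
Proof.
by move=> a b; elim/cLp_piW: F => f; rewrite !cLp_scaleE scalerDl cLp_addE.
Qed.

HB.instance Definition _ := GRing.Zmodule_isLmodule.Build R[i] cLp
  cLp_scalerA cLp_scale1r cLp_scalerDr cLp_scalerDl.

Definition cLp_norm (F : cLp) : R[i] :=
  (fine (cLnorm mu p (val (repr F))))%:C.

Lemma cLnorm_ae (f g : X -> R[i]^o) : cmeasurable f -> cmeasurable g ->
  {ae mu, forall x, f x = g x} -> cLnorm mu p f = cLnorm mu p g.
Proof.
move=> mf mg fg; rewrite /cLnorm unlock; congr (_ `^ _)%E.
have m (l : X -> R[i]^o) : cmeasurable l ->
    measurable_fun [set: X] (fun x => `|(EFin \o (fun x => normc (l x))) x| `^ p)%E.
  move=> ml; apply: (measurableT_comp (measurable_poweR _)).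
  apply: measurableT_comp => //; apply/measurable_EFinP.
  exact: measurable_normc.
apply: ge0_ae_eq_integral => //.
- exact: m.
- exact: m.
- by move=> x _; exact: poweR_ge0.
- by move=> x _; exact: poweR_ge0.
- by apply: filterS fg => x fgx _ /=; rewrite fgx.
Qed.

Lemma cLp_normE (f : cLfunType) :
  cLp_norm (\pi_cLp f) = (fine (cLnorm mu p (val f)))%:C.
Proof.
rewrite /cLp_norm; congr ((fine _)%:C).
have [mf _] := cLfunP _ (valP f).
have [mrf _] := cLfunP _ (valP (repr (\pi_cLp f))).
by apply: cLnorm_ae => //; apply/cLp_piP; rewrite reprK.
Qed.

Lemma cLnorm_fin_num (f : cLfunType) : cLnorm mu p (val f) \is a fin_num.
Proof.
by rewrite ge0_fin_numE ?cLnorm_ge0//; have [] := cLfunP _ (valP f).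
Qed.

Fact cLp_ler_normD F G : cLp_norm (F + G) <= cLp_norm F + cLp_norm G.
Proof.
elim/cLp_piW: F => f; elim/cLp_piW: G => g.
rewrite -cLp_addE !cLp_normE -rmorphD lecR -fineD ?cLnorm_fin_num//.
have [mf _] := cLfunP _ (valP f); have [mg _] := cLfunP _ (valP g).
rewrite fine_le ?fin_numD ?cLnorm_fin_num// raddfD.
exact: cLnormD.
Qed.

Fact cLp_normrZ a F : cLp_norm (a *: F) = `|a| * cLp_norm F.
Proof.
elim/cLp_piW: F => f.
rewrite -[_ *: _]/(cLp_scale _ _) cLp_scaleE !cLp_normE.
have [mf _] := cLfunP _ (valP f).
rewrite linearZ/= cLnormZ// fineM ?cLnorm_fin_num//.
by rewrite rmorphM; congr (_ * _); case: (a).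
Qed.

Fact cLp_normr0_eq0 F : cLp_norm F = 0 -> F = 0.
Proof.
elim/cLp_piW: F => f; rewrite cLp_normE => -[N0].
have [mf _] := cLfunP _ (valP f).
rewrite -(raddf0 \pi_cLp); apply/eqP/cLp_piP.
have p0 : (0 < p%:E)%E by rewrite lte_fin (lt_le_trans _ p1).
have : cLnorm mu p (val f) = 0%E by rewrite -[LHS]fineK ?cLnorm_fin_num ?N0.
have mnf : measurable_fun [set: X] (EFin \o (fun x => normc (val f x))).
  exact/measurable_EFinP/measurable_normc.
move=> /(Lnorm_eq0_eq0 mnf p0).
by apply: filterS => x /(_ I) /= [/eq0_normc].
Qed.

HB.instance Definition _ := Lmodule_isNormed.Build R[i] cLp
  cLp_ler_normD cLp_normrZ cLp_normr0_eq0.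

End Lp_space.

Section nuclear.
Context (R : realType) (Y Z : normedModType R[i]).

(* The norm of [Z] takes values in [R[i]]; being real, it is turned into an
   element of [R] by [Re]. *)
Definition dual_norm (phi : Y -> R[i]) : \bar R :=
  ereal_sup [set (normc (phi y))%:E | y in [set y | `|y| <= 1]].

Definition nuclear (T : {linear Y -> Z}) : Prop :=
  continuous T /\
  exists (phi : nat -> {linear Y -> R[i]^o}) (z : nat -> Z),
    [/\ forall n, continuous (phi n),
        (\sum_(n <oo) dual_norm (phi n) * (Re `|z n|)%:E < +oo)%E &
        forall y, series (fun n => phi n y *: z n) @ \oo --> T y].

End nuclear.

Section conditional_expectation.
Context d (X : measurableType d) (R : realType).
Variables (mu : {measure set X -> \bar R}) (A : set (set X)).

(* [g_sigma_algebraType A] is [X] equipped with the sigma-algebra generated by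
   [A], which is [A] itself when [A] is a sigma-algebra. *)
Definition is_condexp (f g : X -> \bar R) :=
  [/\ forall x, (0 <= g x)%E,
      measurable_fun [set: g_sigma_algebraType A]
        (g : g_sigma_algebraType A -> \bar R) &
      forall B, A B -> (\int[mu]_(x in B) g x = \int[mu]_(x in B) f x)%E].

(* A version of E(f) for measurable f >= 0. Versions exist when [mu] is
   sigma-finite on [A], and any two of them agree almost everywhere, so the
   default value and the choice are immaterial. *)
Definition condexp_ge0 (f : X -> \bar R) : X -> \bar R :=
  xget (cst 0%E) [set g | is_condexp f g].

(* Linear extension to conditionable functions: when E(|f|) < oo, the four
   values below are finite almost everywhere, so [fine] loses nothing. *)
Definition condexp (f : X -> R[i]) (x : X) : R[i] :=
  let E h := fine (condexp_ge0 h x) in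
  let re := EFin \o (fun x => Re (f x)) in
  let im := EFin \o (fun x => Im (f x)) in
  (E (re^\+)%E - E (re^\-)%E) +i* (E (im^\+)%E - E (im^\-)%E).

Definition conditionable (f : X -> R[i]) :=
  cmeasurable f /\
  {ae mu, forall x, (condexp_ge0 (fun x => (normc (f x))%:E) x < +oo)%E}.

Definition atom (B : set X) :=
  [/\ A B, (0 < mu B)%E &
      forall F, A F -> F `<=` B -> mu F = 0%E \/ mu F = mu B].

(* [A] as the sigma-algebra of a measure space, with [mu] restricted to it. *)
Definition sigma_finite_sub :=
  @sigma_finite _ (g_sigma_algebraType A) R [set: X] mu.

Definition nonatomic := forall B, ~ atom B.

Section wce.
Variables (p q : R) (p1 : 1 <= p) (q1 : 1 <= q) (w u : X -> R[i]).

Definition wce (f : X -> R[i]) (x : X) : R[i] :=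
  w x * condexp (fun x => u x * f x) x.

(* The last clause says that T maps the class of f to the class of w E(uf),
   which in particular has to be in L^q. *)
Definition is_wce (T : cLp mu p1 -> cLp mu q1) :=
  [/\ cmeasurable w, cmeasurable u,
      forall f, f \in cLfun mu p1 -> conditionable (fun x => u x * f x) &
      forall f (Lf : f \in cLfun mu p1),
        exists Lg : wce f \in cLfun mu q1, T (cLp_class Lf) = cLp_class Lg].

End wce.
End conditional_expectation.

(* Main.v *)
(** Write a nuclear [T] as [\sum_n phi_n (.) z_n].  The seminorm
    [Q y = \sum_n (normc (phi_n y) * `|z_n|) ^+ 2 / b_n], with
    [b_n = `|phi_n| * `|z_n|], satisfies the parallelogram law, so for vectors
    [x_1, ..., x_N] some choice of signs gives
    [Q (\sum_i +- x_i) <= \sum_i Q x_i].  Take [x_i = f 1_(B_i)] for a partition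
    of [X] into sets [B_i] of [A], fine enough that [`|x_i| <= D] for all [i]; it
    exists because [A] is nonatomic.  Every combination of the [x_i] with
    coefficients of modulus at most 1 has norm at most [`|f|], whence
    [\sum_i Q x_i <= (\sum_n b_n) * D * `|f|].  On the other hand [T] commutes
    with multiplication by [1_(B_i)], so [T (\sum_i +- x_i)] has the same norm
    as [T f] whatever the signs.  Thus [`|T f| = O(Num.sqrt D)], and [D] is
    arbitrary. *)
Require Import Defs.
From HB Require Import structures.
From mathcomp Require Import all_boot all_order all_algebra.
From mathcomp Require Import all_classical all_reals all_analysis.
From mathcomp Require Import measurable_realfun.
From mathcomp Require Import complex.
From mathcomp Require Import ring lra.

Set Implicit Arguments.
Unset Strict Implicit.
Unset Printing Implicit Defensive.

Import Order.TTheory GRing.Theory Num.Theory.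
Import numFieldNormedType.Exports.
Import Normc.

Local Open Scope classical_set_scope.
Local Open Scope ring_scope.

(** * Nuclear operators *)

Section real_valued_norm.
Context (R : realType) (V : normedModType R[i]).
Implicit Types x y : V.

(** The norm of [V] lies in [R[i]], whose order is only partial. [rnorm] is the same number read in
    [R], and [rnormE] shows that nothing is lost. *)
Definition rnorm x : R := complex.Re `|x|.

Lemma rnormE x : `|x| = (rnorm x)%:C%C.
Proof.
by rewrite /rnorm; case: `|x| (normr_ge0 x) => a b /=; rewrite lecE /= => /andP[/eqP ->].
Qed.

Lemma rnorm_ge0 x : 0 <= rnorm x.
Proof. by have := normr_ge0 x; rewrite rnormE -[0]/(0%:C)%C lecR. Qed.

Lemma ler_rnormD x y : rnorm (x + y) <= rnorm x + rnorm y.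
Proof. by have := ler_normD x y; rewrite !rnormE -rmorphD lecR. Qed.

Lemma rnormZ (a : R[i]) x : rnorm (a *: x) = normc a * rnorm x.
Proof.
apply: (@complexI R); rewrite -rnormE normrZ rnormE rmorphM.
by congr (_ * _); case: a.
Qed.

Lemma rnorm0 : rnorm 0 = 0.
Proof. by rewrite /rnorm normr0. Qed.

Lemma rnorm0_eq0 x : rnorm x = 0 -> x = 0.
Proof. by move=> x0; apply/normr0_eq0; rewrite rnormE x0. Qed.

Lemma ler_rnorm_sum N (x : nat -> V) :
  rnorm (\sum_(i < N) x i) <= \sum_(i < N) rnorm (x i).
Proof.
elim: N => [|N IH]; first by rewrite !big_ord0 rnorm0.
rewrite !big_ord_recr /=; apply: le_trans (ler_rnormD _ _) _.
by rewrite lerD2r.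
Qed.

End real_valued_norm.

Lemma normc_ge0 (R : realType) (a : R[i]) : 0 <= normc a.
Proof. by case: a => ? ?; exact: sqrtr_ge0. Qed.

Lemma normc_sqr (R : realType) (a : R[i]) :
  normc a ^+ 2 = complex.Re a ^+ 2 + complex.Im a ^+ 2.
Proof. by case: a => x y; rewrite /= sqr_sqrtr // addr_ge0 ?sqr_ge0. Qed.

Lemma normc_parallelogram (R : realType) (a b : R[i]) :
  normc (a + b) ^+ 2 + normc (a - b) ^+ 2 = 2 * (normc a ^+ 2 + normc b ^+ 2).
Proof. by rewrite !normc_sqr; case: a b => [a1 a2] [b1 b2] /=; ring. Qed.

(** Induction on [N]: with [y] the signed sum already built, [Q (y + x N)] and [Q (y - x N)] have
    average [Q y + Q (x N)], so the smaller of the two does not exceed it. *)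
Lemma parallelogram_signs (R : realDomainType) (V : zmodType) (Q : V -> R)
    (Q0 : Q 0 = 0)
    (Qpar : forall x y, Q (x + y) + Q (x - y) = 2 * (Q x + Q y))
    (N : nat) (x : nat -> V) :
  exists s : nat -> bool,
    Q (\sum_(i < N) (if s i then - x i else x i)) <= \sum_(i < N) Q (x i).
Proof.
elim: N => [|N [s IH]]; first by exists (fun=> false); rewrite !big_ord0 Q0.
set y := \sum_(i < N) _ in IH.
pose s' b i := if i == N then b else s i.
have s'E b : \sum_(i < N.+1) (if s' b i then - x i else x i) =
    y + (if b then - x N else x N).
  rewrite big_ord_recr /= /s' eqxx; congr (_ + _).
  by apply: eq_bigr => i _; rewrite ltn_eqF.
case: (leP (Q (y + x N)) (Q (y - x N))) => h;
  [exists (s' false)|exists (s' true)];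
  rewrite s'E big_ord_recr /=; have := Qpar y (x N); lra.
Qed.

Lemma dual_norm_ge0 (R : realType) (Y : normedModType R[i])
  (phi : {linear Y -> R[i]^o}) : (0 <= dual_norm phi)%E.
Proof.
apply: ereal_sup_ubound; exists 0; first by rewrite /= normr0.
by rewrite linear0 normc0.
Qed.

(** Rescale [y] to norm 1. The product is taken in the extended reals, with [0 * +oo = 0], so no
    finiteness of [dual_norm phi] has to be established first. *)
Lemma le_dual_norm (R : realType) (Y : normedModType R[i])
    (phi : {linear Y -> R[i]^o}) (y : Y) :
  ((normc (phi y))%:E <= dual_norm phi * (rnorm y)%:E)%E.
Proof.
have [y0|y0] := eqVneq (rnorm y) 0.
  by rewrite (rnorm0_eq0 y0) linear0 normc0 rnorm0 mule0.
have yp : 0 < rnorm y by rewrite lt_neqAle eq_sym y0 rnorm_ge0.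
pose a : R[i] := ((rnorm y)^-1)%:C%C.
have na : normc a = (rnorm y)^-1.
  by rewrite /= expr0n addr0 sqrtr_sqr ger0_norm// invr_ge0 ltW.
have : ((normc (phi (a *: y)))%:E <= dual_norm phi)%E.
  apply: ereal_sup_ubound; exists (a *: y) => //=.
  by rewrite rnormE -[1]/(1%:C)%C lecR rnormZ na mulVf.
rewrite linearZ /= normcM na => /(@lee_wpmul2r _ (rnorm y)%:E).
rewrite lee_fin rnorm_ge0 => /(_ isT); apply: le_trans.
by rewrite -EFinM mulrAC mulVf // mul1r.
Qed.

Lemma normc_phase (R : realType) (a : R[i]) :
  exists2 c : R[i], normc c <= 1 & c * a = (normc a)%:C%C.
Proof.
have [->|a0] := eqVneq a 0; first by exists 0; rewrite ?normc0 ?mul0r // ler01.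
have na0 : normc a != 0 by apply: contra_neq a0; exact: eq0_normc.
exists ((normc a)%:C%C / a); last by rewrite divfK.
rewrite normcM normcV /= expr0n addr0 sqrtr_sqr ger0_norm ?normc_ge0 //.
by rewrite divff.
Qed.

(** Choose phases [c i] with [c i * phi (x i) = normc (phi (x i))]: the sum of the moduli is then
    the value of [phi] at the single vector [\sum_i c i *: x i], whose norm is at most [B]. The
    weight [k] will be the norm of [z n], and [M] will be [b n]. *)
Lemma ler_sum_functional (R : realType) (Y : normedModType R[i])
    (phi : {linear Y -> R[i]^o}) (k M : R) (N : nat) (x : nat -> Y) :
  (forall y, normc (phi y) * k <= M * rnorm y) -> 0 <= M ->
  forall B, (forall c : nat -> R[i], (forall i, normc (c i) <= 1) ->
     rnorm (\sum_(i < N) c i *: x i) <= B) ->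
  \sum_(i < N) normc (phi (x i)) * k <= M * B.
Proof.
move=> phiM M0 B xB.
have /choice[c /all_and2[c1 cphi]] i : exists c : R[i],
    normc c <= 1 /\ c * phi (x i) = (normc (phi (x i)))%:C%C.
  by have [c c1 cE] := normc_phase (phi (x i)); exists c.
apply: le_trans (ler_wpM2l M0 (xB c c1)); apply: le_trans (phiM _).
rewrite linear_sum /= (eq_bigr (fun i : 'I_N => (normc (phi (x i)))%:C%C)); last first.
  by move=> i _; rewrite linearZ; exact: cphi.
rewrite -(rmorph_sum (real_complex R)) /= expr0n addr0 sqrtr_sqr -mulr_suml.
by rewrite ger0_norm // sumr_ge0 // => i _; exact: normc_ge0.
Qed.

(** This is the part of the argument that holds in any normed spaces. The facts about [x] that will
    come from L^p are its hypotheses: small pieces, bounded combinations, and no sign change making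
    the image smaller. *)
Lemma nuclear_sign_bound (R : realType) (Y Z : normedModType R[i])
    (T : {linear Y -> Z}) : nuclear T ->
  exists K : R, forall (N : nat) (x : nat -> Y) (D M : R), 0 < D -> 0 < M ->
    (forall i, rnorm (x i) <= D) ->
    (forall c : nat -> R[i], (forall i, normc (c i) <= 1) ->
      rnorm (\sum_(i < N) c i *: x i) <= M) ->
    (forall s : nat -> bool, rnorm (T (\sum_(i < N) x i)) <=
      rnorm (T (\sum_(i < N) (if s i then - x i else x i)))) ->
    rnorm (T (\sum_(i < N) x i)) <= K * Num.sqrt (D * M).
Proof.
move=> [_ [phi [z [_ summ cv]]]].
pose t n := (dual_norm (phi n) * (rnorm (z n))%:E)%E.
have t0 n : (0 <= t n)%E by rewrite mule_ge0 ?dual_norm_ge0 ?lee_fin ?rnorm_ge0.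
pose b n := fine (t n).
have tfin n : t n \is a fin_num.
  rewrite ge0_fin_numE //; apply: le_lt_trans summ.
  apply: le_trans (nneseries_lim_ge n.+1 (fun k _ _ => t0 k)).
  by rewrite big_nat_recr //= leeDr // sume_ge0 // => k _; exact: t0.
have b0 n : 0 <= b n by rewrite fine_ge0.
pose K := fine (\sum_(n <oo) t n)%E.
have bK m : \sum_(n < m) b n <= K.
  rewrite -lee_fin /K fineK; last first.
    by rewrite ge0_fin_numE // nneseries_ge0 // => n _ _; exact: t0.
  rewrite -sumEFin (eq_bigr (fun n : 'I_m => t n)); last first.
    by move=> n _; rewrite fineK.
  rewrite -(big_mkord xpredT t); exact: nneseries_lim_ge.
(* [psi n y] is the norm of the [n]-th term of the series for [T y]. *)
pose psi n y := normc (phi n y) * rnorm (z n).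
have psi0 n y : 0 <= psi n y by rewrite mulr_ge0 ?normc_ge0 ?rnorm_ge0.
have psib n y : psi n y <= b n * rnorm y.
  rewrite -lee_fin EFinM (EFinM (b n)) fineK // /t muleAC.
  by rewrite lee_wpmul2r ?lee_fin ?rnorm_ge0 // le_dual_norm.
exists K => N x D M D0 M0 xD xM Ts.
set theta := Num.sqrt (D * M).
have th0 : 0 < theta by rewrite sqrtr_gt0 mulr_gt0.
have th2 : theta ^+ 2 = D * M by rewrite sqr_sqrtr // mulr_ge0 // ltW.
pose ys (s : nat -> bool) := \sum_(i < N) (if s i then - x i else x i).
pose S m y := series (fun n => phi n y *: z n) m.
have half m : exists s, rnorm (S m (ys s)) <= K * theta.
  (* If [b n = 0], the quotient is 0 by convention; no information is lost, since [psib] forces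
     [psi n] to vanish as well. *)
  pose Q y := \sum_(n < m) psi n y ^+ 2 / b n.
  have Q0 : Q 0 = 0.
    rewrite /Q big1 // => n _.
    by rewrite /psi linear0 normc0 mul0r expr0n mul0r.
  have Qpar y y' : Q (y + y') + Q (y - y') = 2 * (Q y + Q y').
    rewrite /Q -!big_split mulr_sumr; apply: eq_bigr => n _ /=.
    rewrite -!mulrDl mulrA; congr (_ / _).
    rewrite /psi !exprMn -!mulrDl mulrA; congr (_ * _).
    by rewrite linearD linearB /= normc_parallelogram.
  have [s sQ] := parallelogram_signs Q0 Qpar N x.
  exists s; have Qs : Q (ys s) <= K * theta ^+ 2.
    apply: le_trans sQ _; rewrite /Q exchange_big /=.
    apply: le_trans (_ : \sum_(n < m) b n * theta ^+ 2 <= _); last first.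
      by rewrite -mulr_suml ler_wpM2r ?sqr_ge0.
    apply: ler_sum => n _; rewrite -mulr_suml.
    have [bn0|bn0] := eqVneq (b n) 0; first by rewrite bn0 invr0 mulr0 mul0r.
    rewrite ler_pdivrMr ?lt_neqAle 1?eq_sym ?bn0 ?b0 // th2.
    rewrite (_ : _ * b n = b n * D * (b n * M)); last by ring.
    (* One factor of [psi n (x i) ^+ 2] is at most [b n * D] because [x i] is small; the remaining
       factors add up to at most [b n * M] by [ler_sum_functional]. *)
    apply: le_trans (_ : \sum_(i < N) b n * D * psi n (x i) <= _).
      apply: ler_sum => i _; rewrite expr2 ler_wpM2r //.
      by apply: le_trans (psib _ _) _; rewrite ler_wpM2l.
    rewrite -mulr_sumr ler_wpM2l ?mulr_ge0 // ?(ltW D0) //.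
    exact: (ler_sum_functional (psib n) (b0 n) xM).
  apply: le_trans (_ : \sum_(n < m) psi n (ys s) <= _).
    rewrite /S /series /= big_mkord.
    apply: le_trans (ler_rnorm_sum m (fun n => phi n (ys s) *: z n)) _.
    by apply: ler_sum => n _; rewrite rnormZ.
  rewrite -(ler_pM2l (mulr_gt0 (ltr0Sn R 1) th0)).
  apply: le_trans (_ : \sum_(n < m) b n * theta ^+ 2 + Q (ys s) <= _).
    (* AM-GM: [2 theta psi <= b theta ^+ 2 + psi ^+ 2 / b] *)
    rewrite /Q -big_split mulr_sumr; apply: ler_sum => n _ /=.
    have [bn0|bn0] := eqVneq (b n) 0.
      have -> : psi n (ys s) = 0.
        apply/le_anti; rewrite psi0 andbT.
        by apply: le_trans (psib _ _) _; rewrite bn0 mul0r.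
      by rewrite expr0n mulr0 mul0r addr0 mulr_ge0 ?sqr_ge0.
    have bn : 0 < b n by rewrite lt_neqAle eq_sym bn0 b0.
    rewrite -(ler_pM2r bn) [leRHS]mulrDl divfK //.
    have := sqr_ge0 (theta * b n - psi n (ys s)); nra.
  have := ler_wpM2r (sqr_ge0 theta) (bK m); rewrite mulr_suml.
  by move: Qs; rewrite expr2; nra.
apply/ler_addgt0Pr => e e0.
have e0' : 0 < e%:C%C by rewrite -[0]/(0%:C)%C ltcR.
(* The signs given by [half] depend on the truncation, so the truncation must be fixed first. There
   are finitely many sign patterns on ['I_N], and the largest of their thresholds makes the
   truncated series [e]-close to [T] on all of them. *)
pose yf (s : {ffun 'I_N -> bool}) := \sum_(i < N) (if s i then - x i else x i).
have /choice[m Hm] (s : {ffun 'I_N -> bool}) : exists m, forall k, (m <= k)%N ->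
    `|T (yf s) - S k (yf s)| <= e%:C%C.
  have /cvgrPdist_le/(_ _ e0')[m _ mP] := cv (yf s).
  by exists m => k mk; exact: mP.
have [s sP] := half (\max_s m s).
pose s' := [ffun i : 'I_N => s i].
have ysE : ys s = yf s' by apply: eq_bigr => i _; rewrite ffunE.
have := Hm s' _ (leq_bigmax s'); rewrite -ysE rnormE lecR => Tys.
apply: le_trans (Ts s) _.
rewrite -/(ys s) -(subrK (S (\max_s m s)%N (ys s)) (T (ys s))).
by apply: le_trans (ler_rnormD _ _) _; rewrite addrC lerD.
Qed.

(** * Nonatomic measures *)

Section nonatomic_measure.
Context d (X : measurableType d) (R : realType).
Variable m : {measure set X -> \bar R}.
Hypothesis divisible : forall B, measurable B -> (0 < m B < +oo)%E ->
  exists F, [/\ measurable F, F `<=` B & (0 < m F < m B)%E].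

(** Both [F] and its complement in [B] have positive measure, and the lighter one has at most half
    of the measure of [B]. *)
Lemma nonatomic_halving B : measurable B -> (0 < m B < +oo)%E ->
  exists F, [/\ measurable F, F `<=` B, (0 < m F < +oo)%E &
    (m F <= 2^-1%:E * m B)%E].
Proof.
move=> mB Bfin; have [F [mF FB /andP[F0 FltB]]] := divisible mB Bfin.
have [B0 Boo] := andP Bfin.
have mD : measurable (B `\` F) by exact: measurableD.
have Foo : (m F < +oo)%E by exact: lt_trans FltB Boo.
have BE : m B = (m (B `\` F) + m F)%E.
  by rewrite (measureDI m mB mF) setIC setIidl.
have Doo : (m (B `\` F) < +oo)%E.
  by apply: le_lt_trans Boo; rewrite BE leeDl // measure_ge0.
have [D0|D0] := eqVneq (m (B `\` F)) 0%E.
  by move: FltB; rewrite BE D0 add0e ltxx.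
have {}D0 : (0 < m (B `\` F))%E by rewrite lt_neqAle eq_sym D0 measure_ge0.
have Ff : m F \is a fin_num by rewrite ge0_fin_numE // ltW.
have Df : m (B `\` F) \is a fin_num by rewrite ge0_fin_numE // ltW.
case: (leP (m F) (m (B `\` F))) => h; [exists F|exists (B `\` F)]; split => //;
  rewrite ?F0 ?D0 // BE; move: h;
  rewrite -(fineK Ff) -(fineK Df) -EFinD -EFinM ?lee_fin ?lte_fin; lra.
Qed.

Lemma nonatomic_small_subset B (e : R) : measurable B -> (0 < m B < +oo)%E -> 0 < e ->
  exists F, [/\ measurable F, F `<=` B, (0 < m F)%E & (m F <= e%:E)%E].
Proof.
move=> mB Bfin e0.
have Bf : m B \is a fin_num by case/andP: Bfin => B0 ?; rewrite ge0_fin_numE // ltW.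
have iter k : exists F, [/\ measurable F, F `<=` B, (0 < m F < +oo)%E &
    (m F <= (2^-1 ^+ k)%:E * m B)%E].
  elim: k => [|k [F [mF FB Ffin FE]]]; first by exists B; rewrite expr0 mul1e; split.
  have [G [mG GF Gfin GE]] := nonatomic_halving mF Ffin.
  exists G; split => //; first exact: subset_trans FB.
  apply: le_trans GE _; rewrite exprS EFinM -muleA.
  by rewrite lee_wpmul2l // lee_fin invr_ge0.
(* With [k = Num.bound (fine (m B) / e)], one has [fine (m B) / e < 2 ^+ k], so [k] halvings
   suffice. *)
have [F [mF FB /andP[F0 _] FE]] := iter (Num.bound (fine (m B) / e)).
exists F; split => //; apply: le_trans FE _.
have := upper_nthrootP (leqnn (Num.bound (fine (m B) / e))).
set k := Num.bound _ => h; rewrite -(fineK Bf) -EFinM lee_fin exprVn mulrC.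
by rewrite ler_pdivrMr ?exprn_gt0 // mulrC -ler_pdivrMr // ltW.
Qed.

(** Finite disjoint unions of measurable sets of measure at most [e]. The inductive form lets pieces
    be added one at a time; [small_union_seq] recovers an indexed family. *)
Inductive small_union (e : R) : set X -> Prop :=
| small_union0 : small_union e set0
| small_unionU G C : small_union e G -> measurable C -> (m C <= e%:E)%E ->
    G `&` C = set0 -> small_union e (G `|` C).

Lemma small_union_measurable e G : small_union e G -> measurable G.
Proof. by elim=> // {}G C _ mG mC _ _; exact: measurableU. Qed.

(** Each piece [C] of [H] is replaced by the part of it not yet covered, which stays small and
    restores disjointness. *)
Lemma small_union_setU e G H :
  small_union e G -> small_union e H -> small_union e (G `|` H).
Proof.
move=> sG; elim=> [|{}H C sH sGH mC Ce _]; first by rewrite setU0.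
have mGH := small_union_measurable sGH.
rewrite setUA -(setDUK (@subsetUl _ (G `|` H) C)) setDUl setDv set0U.
apply: small_unionU => //; first exact: measurableD.
  by apply: le_trans Ce; apply: le_measure; rewrite ?inE //; exact: measurableD.
by rewrite setDIK.
Qed.

Lemma small_union_bigsetU e (G : nat -> set X) k :
  (forall i, small_union e (G i)) -> small_union e (\big[setU/set0]_(i < k) G i).
Proof.
move=> sG; elim: k => [|k IH]; first by rewrite big_ord0; exact: small_union0.
by rewrite big_ord_recr; exact: small_union_setU.
Qed.

Lemma small_union_seq e G : 0 <= e -> small_union e G ->
  exists (N : nat) (B : nat -> set X),
  [/\ forall i, measurable (B i), forall i, (m (B i) <= e%:E)%E,
      forall i j, i != j -> B i `&` B j = set0 & G = \bigcup_(i < N) B i].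
Proof.
move=> e0 sG; suff [N [B [mB Be BB GE _]]] : exists (N : nat) (B : nat -> set X),
    [/\ forall i, measurable (B i), forall i, (m (B i) <= e%:E)%E,
        forall i j, i != j -> B i `&` B j = set0, G = \bigcup_(i < N) B i &
        forall i, (N <= i)%N -> B i = set0] by exists N, B.
elim: sG => [|{}G C sG [N [B [mB Be BB GE B0]]] mC Ce GC0].
  exists 0%N, (fun=> set0); split => //.
  - by move=> i; rewrite measure0 lee_fin.
  - by move=> i j _; rewrite setI0.
  - by rewrite bigcup0.
have BC i : B i `&` C = set0.
  have [iN|/B0 ->] := ltnP i N; last by rewrite set0I.
  by rewrite -subset0 => x [Bx Cx]; rewrite -GC0 GE; split => //; exists i.
exists N.+1, (fun i => if i == N then C else B i); split.
- by move=> i; case: ifP.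
- by move=> i; case: ifP.
- move=> i j; case: ifPn => [/eqP ->|iN]; case: ifPn => [/eqP ->|jN] ij //.
  + by rewrite eqxx in ij.
  + by rewrite setIC.
  + exact: BB.
- rewrite bigcup_mkord big_ord_recr /= eqxx GE bigcup_mkord; congr (_ `|` _).
  by apply: eq_bigr => i _; rewrite ltn_eqF.
- by move=> i Ni; rewrite gtn_eqF // B0 // ltnW.
Qed.

(** Exhaustion: let [G k] be small unions in [S] whose measures approach the supremum. Their union
    [U] fills [S] up to a null set, so finitely many of them leave a remainder of measure at most
    [e], which serves as one more piece. *)
Lemma nonatomic_partition S (e : R) : measurable S -> (m S < +oo)%E -> 0 < e ->
  small_union e S.
Proof.
move=> mS Soo e0.
have Sf : m S \is a fin_num by rewrite ge0_fin_numE // measure_ge0.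
pose E := [set r | exists G, [/\ small_union e G, G `<=` S & m G = r%:E]].
have Efine G : small_union e G -> G `<=` S -> m G \is a fin_num.
  move=> sG GS; rewrite ge0_fin_numE ?measure_ge0 //; apply: le_lt_trans Soo.
  by apply: le_measure; rewrite ?inE //; exact: small_union_measurable sG.
have hE : has_sup E.
  split; first by exists 0, set0; split=> //; [exact: small_union0|rewrite measure0].
  exists (fine (m S)) => r [G [sG GS Gr]]; rewrite -lee_fin -Gr fineK //.
  by apply: le_measure; rewrite ?inE //; exact: small_union_measurable sG.
have /choice[G GP] k : exists G, [/\ small_union e G, G `<=` S &
    ((sup E - k.+1%:R^-1)%:E < m G)%E].
  have k0 : 0 < k.+1%:R^-1 :> R by rewrite invr_gt0.
  have [r [G [sG GS Gr]] rs] := sup_adherent k0 hE.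
  by exists G; split => //; rewrite Gr lte_fin.
have mG k : measurable (G k) by have [/small_union_measurable] := GP k.
pose U := \bigcup_k G k.
have mU : measurable U by exact: bigcup_measurable.
have US : U `<=` S by move=> x [k _]; have [_ + _] := GP k; exact.
have mSU : measurable (S `\` U) by exact: measurableD.
have SU0 : m (S `\` U) = 0%E.
  apply/eqP/negPn/negP => SU0.
  (* A small set [C] of positive measure outside [U] is disjoint from every [G k]. Added to a [G k]
     whose measure is within [m C] of the supremum, it would exceed the supremum. *)
  have [|C [mC CSU C0 Ce]] := nonatomic_small_subset mSU _ e0.
    rewrite lt_neqAle eq_sym SU0 measure_ge0 /=; apply: le_lt_trans Soo.
    by apply: le_measure; rewrite ?inE //; exact: subDsetl.
  have Cf : m C \is a fin_num.
    by rewrite ge0_fin_numE ?measure_ge0 // (le_lt_trans Ce) ?ltry.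
  have c0 : 0 < fine (m C) by rewrite fine_gt0 // C0 ltey_eq Cf.
  have [k _ /(_ _ (leqnn k)) kc] := near_infty_natSinv_lt (PosNum c0).
  have [sG GS Gsup] := GP k.
  have GC0 : G k `&` C = set0.
    rewrite -subset0 => x [Gx /CSU[_ nU]]; apply: nU; by exists k.
  have /(sup_upper_bound hE) : E (fine (m (G k `|` C))).
    exists (G k `|` C); split; first exact: small_unionU.
      by move=> x [/GS//|/CSU[]].
    rewrite fineK //; apply: Efine; first exact: small_unionU.
    by move=> x [/GS//|/CSU[]].
  rewrite measureU // fineD // ?Efine // => supGC.
  move: Gsup; rewrite -(fineK (Efine _ sG GS)) lte_fin /=.
  by move=> Gsup; have := lt_le_trans (ltrD Gsup kc) supGC; rewrite subrK ltxx.
pose H k := \big[setU/set0]_(i < k) G i.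
have mH k : measurable (H k) by exact: bigsetU_measurable.
have HS k : H k `<=` S.
  by rewrite /H -bigcup_mkord => x [i _]; have [_ + _] := GP i; exact.
have : m (S `\` H k) @[k --> \oo] --> m (\bigcap_k (S `\` H k)).
  apply: nonincreasing_cvg_mu.
  - by apply: le_lt_trans Soo; apply: le_measure; rewrite ?inE //; exact: measurableD.
  - by move=> k; exact: measurableD.
  - by apply: bigcap_measurable => // k _; exact: measurableD.
  - move=> a b ab; apply/subsetPset => x [Sx nHb]; split => //.
    apply: contra_not nHb; rewrite /H -!bigcup_mkord => -[i /= ia Gx].
    by exists i => //=; exact: leq_trans ab.
have -> : \bigcap_k (S `\` H k) = S `\` U.
  apply/seteqP; split => [x Sx|x [Sx nU] k _]; last first.
    split => //; rewrite /H -bigcup_mkord => -[i _ Gx]; apply: nU; by exists i.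
  split; first by have [] := Sx 0%N I.
  move=> [k _ Gx]; have [_] := Sx k.+1 I; apply.
  by rewrite /H -bigcup_mkord; exists k => /=.
(* Continuity from above yields a [k] for which [S \ H k] has measure at most [e]. *)
rewrite SU0 => /fine_cvgP [_ /cvgrPdist_le /(_ _ e0)[k _ /(_ k (leqnn k))]].
rewrite sub0r normrN => he.
have -> : S = H k `|` (S `\` H k) by rewrite setDUK.
apply: small_unionU; [|exact: measurableD| |by rewrite setDIK].
  by apply: small_union_bigsetU => i; have [] := GP i.
have SHf : m (S `\` H k) \is a fin_num.
  rewrite ge0_fin_numE ?measure_ge0 //; apply: le_lt_trans Soo.
  by apply: le_measure; rewrite ?inE //; exact: measurableD.
rewrite -(fineK SHf) lee_fin; exact: le_trans (ler_norm _) he.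
Qed.
End nonatomic_measure.

(** * Conditional expectation *)

(** The integrals may be infinite, so [loc] compares the functions on sets of finite measure where
    the first one is bounded. This settles the points where [f] is finite and, by symmetry, those
    where [g] is; elsewhere both are [+oo]. *)
Lemma sigma_finite_integral_ae_eq d (X : measurableType d) (R : realType)
    (m : {measure set X -> \bar R}) (f g : X -> \bar R) :
  sigma_finite [set: X] m ->
  measurable_fun [set: X] f -> measurable_fun [set: X] g ->
  (forall x, (0 <= f x)%E) -> (forall x, (0 <= g x)%E) ->
  (forall B, measurable B -> (\int[m]_(x in B) f x = \int[m]_(x in B) g x)%E) ->
  {ae m, forall x, f x = g x}.
Proof.
move=> /sigma_finiteP[F [FT Fnd /all_and2[mF Foo]]].
have loc (a b : X -> \bar R) : measurable_fun [set: X] a -> measurable_fun [set: X] b ->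
    (forall x, (0 <= a x)%E) ->
    (forall B, measurable B -> (\int[m]_(x in B) a x = \int[m]_(x in B) b x)%E) ->
    {ae m, forall x, (a x < +oo)%E -> a x = b x}.
  move=> ma mb a0 ab.
  pose D k := F k `&` [set x | (a x <= k%:R%:E)%E].
  have mD k : measurable (D k).
    apply: measurableI => //; rewrite -[X in measurable X]setTI.
    by apply: emeasurable_fun_le => //; exact: measurable_cst.
  have Dab k : ae_eq m (D k) a b.
    apply: integral_ae_eq => //; [|exact: measurable_funTS|by move=> E _; exact: ab].
    apply/integrableP; split; first exact: measurable_funTS.
    apply: (@le_lt_trans _ _ (\int[m]_(x in D k) k%:R%:E)%E).
      apply: ge0_le_integral => //.
      - by apply: measurableT_comp => //; exact: measurable_funTS.
      - by move=> x [_]; rewrite gee0_abs.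
    rewrite integral_cst // lte_mul_pinfty ?lee_fin //.
    apply: le_lt_trans (Foo k); apply: le_measure; rewrite ?inE //; exact: subIsetl.
  have := ae_foralln Dab; apply: filterS => x Dx axoo.
  have [k _ Fkx] : (\bigcup_i F i) x by rewrite -FT.
  have [n an] : exists n, (a x <= n%:R%:E)%E.
    have afin : a x \is a fin_num by rewrite ge0_fin_numE.
    exists (Num.bound (fine (a x))); rewrite -(fineK afin) lee_fin ltW //.
    by rewrite archi_boundP // fine_ge0.
  apply: (Dx (maxn k n)); split.
    by have /subsetPset := Fnd _ _ (leq_maxl k n); apply.
  by apply: le_trans an _; rewrite lee_fin ler_nat leq_maxr.
move=> mf mg f0 g0 fg.
have := loc _ _ mf mg f0 fg.
have := loc _ _ mg mf g0 (fun B mB => esym (fg B mB)).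
apply: filterS2 => x gx fx.
have [/fx//|fxoo] := ltP (f x) +oo%E; have [/gx //|gxoo] := ltP (g x) +oo%E.
by move: fxoo gxoo; rewrite !leye_eq => /eqP -> /eqP ->.
Qed.

Section conditional_expectation.
Context d (X : measurableType d) (R : realType).
Variables (mu : {measure set X -> \bar R}) (A : set (set X)).
Hypothesis A_sigma : sigma_algebra [set: X] A.
Hypothesis A_sub : A `<=` @measurable d X.
Local Notation Y := (g_sigma_algebraType A).

Lemma sub_measurableE (B : set X) : @measurable _ Y B = A B.
Proof. by rewrite measurable_g_measurableTypeE. Qed.

Lemma measurable_sub_id : measurable_fun [set: X] (id : X -> Y).
Proof. by move=> _ B; rewrite sub_measurableE setTI => /A_sub. Qed.

(** The restriction of [mu] to [A], as the image of [mu] under the identity from [X] to [Y], which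
    is measurable because [A] is contained in the sigma-algebra of [X]. [Defined] keeps its values
    convertible to those of [mu]. *)
Definition submeasure : {measure set Y -> \bar R}.
Proof. by refine (pushforward mu (id : X -> Y)); exact: measurable_sub_id. Defined.

Lemma submeasureE (B : set X) : submeasure B = mu B.
Proof. by []. Qed.

Lemma sub_measurable_fun d' (Z : measurableType d') (f : X -> Z) :
  measurable_fun [set: Y] (f : Y -> Z) -> measurable_fun [set: X] f.
Proof.
by move=> mf _ C mC; have := mf measurableT C mC; rewrite sub_measurableE => /A_sub.
Qed.

Lemma integral_submeasure (D : set X) (f : X -> \bar R) : A D ->
  measurable_fun [set: Y] (f : Y -> \bar R) -> (forall x, (0 <= f x)%E) ->
  (\int[submeasure]_(x in D) f x = \int[mu]_(x in D) f x)%E.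
Proof.
move=> AD mf f0; rewrite (ge0_integral_pushforward measurable_sub_id) //.
  by rewrite sub_measurableE.
exact: measurable_funTS.
Qed.

Lemma submeasure_ae (P : X -> Prop) :
  {ae submeasure, forall x, P x} -> {ae mu, forall x, P x}.
Proof.
move=> [N [mN N0 PN]]; exists N; split => //.
by move: mN; rewrite sub_measurableE => /A_sub.
Qed.

Hypothesis A_sigma_finite : sigma_finite_sub mu A.

Lemma condexp_unique (f g1 g2 : X -> \bar R) :
  is_condexp mu A f g1 -> is_condexp mu A f g2 -> {ae mu, forall x, g1 x = g2 x}.
Proof.
move=> [g10 mg1 g1f] [g20 mg2 g2f]; apply: submeasure_ae.
apply: sigma_finite_integral_ae_eq => //.
move=> B; rewrite sub_measurableE => AB.
by rewrite !integral_submeasure // g1f // g2f.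
Qed.

(** Integrating over [C] after restriction to [B] means integrating over the intersection of [C] and
    [B], which is again in [A]. *)
Lemma is_condexp_restrict (B : set X) (f g : X -> \bar R) : A B ->
  is_condexp mu A f g -> is_condexp mu A (f \_ B) (g \_ B).
Proof.
move=> AB [g0 mg gf]; split.
- by move=> x; rewrite patchE; case: ifP.
- have mB : @measurable _ Y B by rewrite sub_measurableE.
  by apply/(measurable_restrictT _ mB); exact: measurable_funTS.
- move=> C AC; rewrite -!integral_mkcondr; apply: gf.
  by move: AB AC; rewrite -!sub_measurableE => AB AC; exact: measurableI.
Qed.

(** The conditional expectation is the Radon-Nikodym derivative, on [A], of the finite measure [nu]
    with density [f] with respect to [submeasure]. *)
Lemma integral_condexp_finite (f : X -> \bar R) : measurable_fun [set: X] f ->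
  (forall x, (0 <= f x)%E) -> (\int[mu]_x f x < +oo)%E ->
  exists g, is_condexp mu A f g.
Proof.
move=> mf f0 foo.
pose nu (B : set Y) := (\int[mu]_(x in B) f x)%E.
have nu0 : nu set0 = 0%E by rewrite /nu integral_set0.
have nupos B : (0 <= nu B)%E by exact: integral_ge0.
have nuadd : semi_sigma_additive nu.
  move=> F mF tF mUF; apply: semi_sigma_additive_nng_induced => //.
  - by move=> i; have := mF i; rewrite sub_measurableE => /A_sub.
  - by move: mUF; rewrite sub_measurableE => /A_sub.
have nufin : fin_num_fun nu.
  move=> B; rewrite sub_measurableE => /A_sub mB.
  rewrite ge0_fin_numE //; apply: le_lt_trans foo.
  exact: ge0_subset_integral.
pose nuM := isMeasure.Build _ _ _ nu nu0 nupos nuadd.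
pose nu' : {measure set Y -> \bar R} := HB.pack nu nuM.
pose nuF := @Measure_isFinite.Build _ _ _ nu' nufin.
pose nu'' : {finite_measure set Y -> \bar R} := HB.pack nu nuM nuF.
pose m : set Y -> \bar R := submeasure.
pose mM := isMeasure.Build _ _ _ m (measure0 submeasure)
  (measure_ge0 submeasure) (@measure_semi_sigma_additive _ _ _ submeasure).
pose m1 : {measure set Y -> \bar R} := HB.pack m mM.
pose mS := @Measure_isSigmaFinite.Build _ _ _ m1 A_sigma_finite.
pose m' : {sigma_finite_measure set Y -> \bar R} := HB.pack m mM mS.
have [|g [g0 _ gint gnu]] := @radon_nikodym_sigma_finite _ Y R m' nu''.
  apply/null_content_dominatesP => B mB B0.
  apply: null_set_integral => //.
    by move: mB; rewrite sub_measurableE => /A_sub.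
  exact: measurable_funTS.
have mg := measurable_int _ gint.
exists g; split => // B AB.
rewrite -integral_submeasure //.
by rewrite -[RHS]/(nu'' B) gnu // sub_measurableE.
Qed.

Hypothesis mu_sigma_finite : sigma_finite [set: X] mu.

(** Cut [X] into countably many disjoint sets [D k] of finite measure on which [f] is at most [k],
    and add up the conditional expectations of the pieces of [f]. The [D k] are measurable in [X]
    but need not belong to [A]. *)
Lemma condexp_exists (f : X -> R) : measurable_fun [set: X] f ->
  (forall x, 0 <= f x) -> exists g, is_condexp mu A (EFin \o f) g.
Proof.
move=> mf f0.
have /sigma_finiteP[F [FT Fnd /all_and2[mF Foo]]] := mu_sigma_finite.
pose E k := F k `&` [set x | f x <= k%:R].
have mE k : measurable (E k).
  apply: measurableI => //; rewrite -[X in measurable X]setTI.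
  by apply: measurable_fun_le => //; exact: measurable_cst.
pose D := seqDU E.
have DE k : D k `<=` F k `&` [set x | f x <= k%:R] by exact: subset_seqDU.
have mD k : measurable (D k) by exact: seqDU_measurable.
have DT : \bigcup_k D k = [set: X].
  rewrite -subTset -seqDU_bigcup_eq => x _.
  have [k _ Fkx] : (\bigcup_i F i) x by rewrite -FT.
  pose n := Num.bound (f x).
  exists (maxn k n) => //; split.
    by have /subsetPset := Fnd _ _ (leq_maxl k n); apply.
  apply: le_trans (ltW (archi_boundP (f0 x))) _.
  by rewrite ler_nat leq_maxr.
have mfE : measurable_fun [set: X] (EFin \o f) by exact/measurable_EFinP.
have fE0 x : (0 <= (EFin \o f) x)%E by rewrite lee_fin.
have /choice[g gP] k : exists g, is_condexp mu A ((EFin \o f) \_ (D k)) g.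
  apply: integral_condexp_finite.
  - by apply/(measurable_restrictT _ (mD k)); exact: measurable_funTS.
  - by move=> x; rewrite patchE; case: ifP.
  rewrite -integral_mkcond.
  apply: (@le_lt_trans _ _ (\int[mu]_(x in D k) k%:R%:E)%E).
    apply: ge0_le_integral => //; first exact: measurable_funTS.
    by move=> x /DE[]; rewrite lee_fin.
  rewrite integral_cst // lte_mul_pinfty ?lee_fin //.
  apply: le_lt_trans (Foo k); apply: le_measure; rewrite ?inE //.
  by move=> x /DE[].
have g0 k x : (0 <= g k x)%E by have [] := gP k.
have mg k : measurable_fun [set: Y] (g k : Y -> \bar R) by have [] := gP k.
exists (fun x => \sum_(k <oo) g k x)%E; split.
- by move=> x; apply: nneseries_ge0.
- by apply: ge0_emeasurable_sum.
- move=> B AB; have mB := A_sub AB.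
  rewrite integral_nneseries //; last first.
    by move=> k; apply: measurable_funTS; exact: sub_measurable_fun.
  rewrite (eq_eseriesr
    (g := fun k => \int[mu]_(x in B `&` D k) (EFin \o f) x))%E; last first.
    by move=> k _; have [_ _ ->] := gP k; rewrite // integral_mkcondr.
  rewrite -ge0_integral_bigcup -?setI_bigcupr ?DT ?setIT //.
  + by move=> k; exact: measurableI.
  + exact: measurable_funTS.
  + exact/trivIset_setIl/trivIset_seqDU.
Qed.

End conditional_expectation.

(** * Restriction to sets of [A], and partitions of [X] into sets of [A] *)

Definition crestrict (X : Type) (R : realType) (B : set X) (f : X -> R[i]^o) :
  X -> R[i]^o := fun x => if x \in B then f x else 0.

Section weighted_conditional_expectation.
Context d (X : measurableType d) (R : realType).
Variables (mu : {measure set X -> \bar R}) (A : set (set X)).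
Hypothesis A_sigma : sigma_algebra [set: X] A.
Hypothesis A_sub : A `<=` @measurable d X.
Hypothesis A_sigma_finite : sigma_finite_sub mu A.
Hypothesis mu_sigma_finite : sigma_finite [set: X] mu.

Lemma condexp_ge0_restrict (B : set X) (f : X -> R) : A B ->
  measurable_fun [set: X] f -> (forall x, 0 <= f x) ->
  {ae mu, forall x, condexp_ge0 mu A ((EFin \o f) \_ B) x =
    (condexp_ge0 mu A (EFin \o f) \_ B) x}.
Proof.
move=> AB mf f0.
have [g gf] := condexp_exists A_sigma A_sub A_sigma_finite mu_sigma_finite mf f0.
(* Since a version exists, [xget] returns a version and not its default value. *)
have Ef : is_condexp mu A (EFin \o f) (condexp_ge0 mu A (EFin \o f)).
  by apply: (xgetPex (cst 0%E)); exists g.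
have EfB := is_condexp_restrict A_sigma AB Ef.
apply: (condexp_unique A_sigma A_sub A_sigma_finite _ EfB).
by apply: (xgetPex (cst 0%E)); exists (condexp_ge0 mu A (EFin \o f) \_ B).
Qed.

Lemma condexp_crestrict (B : set X) (f : X -> R[i]^o) : A B -> cmeasurable f ->
  {ae mu, forall x, condexp mu A (crestrict B f) x = crestrict B (condexp mu A f) x}.
Proof.
move=> AB [mre mim].
(* The positive part is rewritten as the real-valued function [Num.max (h x) 0], to which
   [condexp_ge0_restrict] applies; [negpart] is [part] for [- h]. *)
have part (h : X -> R) : measurable_fun [set: X] h ->
    {ae mu, forall x, fine (condexp_ge0 mu A (((EFin \o h) \_ B)^\+)%E x) =
      if x \in B then fine (condexp_ge0 mu A ((EFin \o h)^\+)%E x) else 0}.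
  move=> mh.
  have mhp : measurable_fun [set: X] (fun x => Num.max (h x) 0).
    by apply: measurable_maxr => //; exact: measurable_cst.
  have hp0 x : 0 <= Num.max (h x) 0 by rewrite le_max lexx orbT.
  have := condexp_ge0_restrict AB mhp hp0; apply: filterS => x.
  have -> : EFin \o (fun x => Num.max (h x) 0) = ((EFin \o h)^\+)%E.
    by apply/funext => y; rewrite /= funeposE EFin_max.
  by rewrite -funepos_restrict => ->; rewrite patchE; case: ifP.
have negpart (h : X -> R) : measurable_fun [set: X] h ->
    {ae mu, forall x, fine (condexp_ge0 mu A (((EFin \o h) \_ B)^\-)%E x) =
      if x \in B then fine (condexp_ge0 mu A ((EFin \o h)^\-)%E x) else 0}.
  move=> mh; have := part _ (measurableT_comp (@oppr_measurable R _) mh).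
  apply: filterS => x.
  have -> : EFin \o (-%R \o h) = (\- (EFin \o h))%E by [].
  have -> : ((\- (EFin \o h)) \_ B = \- ((EFin \o h) \_ B))%E.
    by apply/funext => y; rewrite !patchE; case: ifP; rewrite ?oppe0.
  by rewrite !funeposN.
have reB : EFin \o (fun x => complex.Re (crestrict B f x)) =
    (EFin \o (fun x => complex.Re (f x))) \_ B.
  by apply/funext => x; rewrite patchE /= /crestrict; case: ifP.
have imB : EFin \o (fun x => complex.Im (crestrict B f x)) =
    (EFin \o (fun x => complex.Im (f x))) \_ B.
  by apply/funext => x; rewrite patchE /= /crestrict; case: ifP.
have rep := part _ mre; have ren := negpart _ mre.
have imp := part _ mim; have imn := negpart _ mim.
apply: filterS2 (filterI rep ren) (filterI imp imn) => x [pr nr] [pi ni].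
rewrite /condexp reB imB pr nr pi ni /crestrict.
by case: ifP; rewrite // !subrr.
Qed.

(** Indicators of sets of [A] can be pulled out of the conditional expectation, and they commute
    with multiplication by [w] and [u]. *)
Lemma wce_crestrict (w u : X -> R[i]) (B : set X) (f : X -> R[i]^o) : A B ->
  cmeasurable (fun x => u x * f x : R[i]^o) ->
  {ae mu, forall x, wce mu A w u (crestrict B f) x = crestrict B (wce mu A w u f) x}.
Proof.
move=> AB muf.
have uE : (fun x => u x * crestrict B f x) = crestrict B (fun x => u x * f x : R[i]^o).
  by apply/funext => y; rewrite /crestrict; case: ifP; rewrite // mulr0.
have := condexp_crestrict AB muf; apply: filterS => x.
rewrite /wce uE => ->; rewrite /crestrict; case: ifP => // _; exact: mulr0.
Qed.

Hypothesis A_nonatomic : nonatomic mu A.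

(** If no such [F] existed, [B] itself would be an atom. *)
Lemma nonatomic_divisible (B : set (g_sigma_algebraType A)) :
  measurable B -> (0 < submeasure mu A_sigma A_sub B < +oo)%E ->
  exists F, [/\ measurable F, F `<=` B &
    (0 < submeasure mu A_sigma A_sub F < submeasure mu A_sigma A_sub B)%E].
Proof.
rewrite sub_measurableE // => AB /andP[B0 Boo]; apply: contrapT => nF.
apply: (A_nonatomic (B := B)); split => // F AF FB.
have [F0|F0] := eqVneq (mu F) 0%E; first by left.
right; apply: contrapT => FltB; apply: nF; exists F; split => //.
  by rewrite sub_measurableE.
rewrite !submeasureE !lt_neqAle eq_sym F0 measure_ge0 /=.
by rewrite le_measure ?inE ?andbT; [exact/eqP|exact: A_sub|exact: A_sub|].
Qed.

(** Outside a large [F k] of finite measure the integral of [h] is small, by monotone convergence.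
    Inside, absolute continuity of the integral makes it small on every set of small measure, and
    [nonatomic_partition] cuts [F k] into such sets. *)
Lemma nonatomic_small_partition (h : X -> R) (e : R) :
  mu.-integrable [set: X] (EFin \o h) -> (forall x, 0 <= h x) -> 0 < e ->
  exists (N : nat) (B : nat -> set X),
  [/\ forall i, A (B i), forall i, (\int[mu]_(x in B i) (h x)%:E <= e%:E)%E,
      forall i j, i != j -> B i `&` B j = set0 & \bigcup_(i < N) B i = [set: X]].
Proof.
move=> inth h0 e0.
have /sigma_finiteP[F [FT Fnd /all_and2[AF Foo]]] :
  sigma_finite [set: g_sigma_algebraType A] (submeasure mu A_sigma A_sub) by [].
have mh := measurable_int _ inth.
have mF k : measurable (F k : set X).
  by have := AF k; rewrite sub_measurableE // => /A_sub.
have hfin (C : set X) : measurable C -> (\int[mu]_(x in C) (h x)%:E)%E \is a fin_num.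
  by move=> mC; apply: integrable_fin_num => //; exact: integrableS inth.
have [k hk] : exists k, (\int[mu]_(x in ~` (F k)) (h x)%:E <= e%:E)%E.
  have : (\int[mu]_(x in F k) (h x)%:E)%E @[k --> \oo] -->
      (\int[mu]_(x in \bigcup_k F k) (h x)%:E)%E.
    apply: ge0_nondecreasing_set_cvg_integral => //.
    - by move=> i; exact: measurable_funTS.
    - by move=> i x _; rewrite lee_fin.
  rewrite -FT -[X in _ --> X](fineK (hfin _ measurableT)).
  move=> /fine_cvgP[_ /cvgrPdist_le/(_ _ e0)[k _ /(_ k (leqnn k)) /= hk]].
  exists k; have mFC := measurableC (mF k).
  have := @ge0_integral_setU _ _ _ mu (F k) (~` F k) (mF k) mFC (EFin \o h).
  rewrite setUv => /(_ mh) hU; rewrite -(fineK (hfin _ mFC)) lee_fin.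
  have {}hU : fine (\int[mu]_x (h x)%:E) =
      fine (\int[mu]_(x in F k) (h x)%:E) + fine (\int[mu]_(x in ~` F k) (h x)%:E).
    rewrite -fineD ?hfin // -hU //; last by rewrite disj_set2E setICr.
    by move=> x _; rewrite lee_fin.
  by move: hk; rewrite hU addrC addKr; apply: le_trans; exact: ler_norm.
have [r [r0 hr]] := integral_normr_continuous inth e0.
(* Pieces of measure at most [r / 2] satisfy the strict bound [mu B < r] that [hr] asks for. *)
have r20 : 0 < r / 2 by rewrite divr_gt0.
have sF := nonatomic_partition nonatomic_divisible (AF k) (Foo k) r20.
have [N [B [mB Br BB BF]]] := small_union_seq (ltW r20) sF.
have AB i : A (B i) by have := mB i; rewrite sub_measurableE.
have AFk : A (F k) by have := AF k; rewrite sub_measurableE.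
(* Index 0 is the complement of [F k]. Intersecting the other sets with [F k] keeps them disjoint
   from it for all indices, including those beyond the union that covers [F k]. *)
exists N.+1, (fun i => if i is j.+1 then B j `&` F k else ~` F k); split.
- case=> [|i].
    by have := AFk; rewrite -!(sub_measurableE A_sigma); exact: measurableC.
  have := AB i; have := AFk; rewrite -!(sub_measurableE A_sigma) => ? ?.
  exact: measurableI.
- case=> [//|i].
  have mBF : measurable (B i `&` F k : set X) by apply: measurableI => //; exact: A_sub.
  have : (mu (B i `&` F k) < r%:E)%E.
    apply: (@le_lt_trans _ _ (r / 2)%:E); last by rewrite lte_fin; lra.
    have mBi : measurable (B i : set X) by apply: A_sub.
    by apply: le_trans (Br i); apply: (@le_measure _ _ _ mu);
      rewrite ?inE //; exact: subIsetl.
  move=> /(hr _ mBF) /ltW; rewrite -(fineK (hfin _ mBF)) lee_fin.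
  rewrite /Rintegral; under eq_integral do rewrite ger0_norm //; exact.
- case=> [|i] [|j] ij //.
  + by rewrite setICA setICl setI0.
  + by rewrite -setIA setICr setI0.
  + by rewrite setIACA (BB i j ij) set0I.
- apply/seteqP; split => // x _.
  have [Fx|nFx] := pselect (F k x); last by exists 0%N.
  have [i /= iN Bx] : (\bigcup_(i < N) B i) x by rewrite -BF.
  by exists i.+1.
Qed.

End weighted_conditional_expectation.

(** * Restriction in L^p *)

Section Lp_restriction.
Context d (X : measurableType d) (R : realType).
Variables (mu : {measure set X -> \bar R}) (p : R) (p1 : 1 <= p).
Implicit Types f g : X -> R[i]^o.

Let p0 : 0 < p. Proof. exact: lt_le_trans p1. Qed.

Lemma cLnormE f : cLnorm mu p f =
  ((\int[mu]_x (normc (f x) `^ p)%:E) `^ p^-1)%E.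
Proof.
rewrite /cLnorm unlock; congr (_ `^ _)%E; apply: eq_integral => x _ /=.
by rewrite ger0_norm // normc_ge0.
Qed.

Lemma le_cLnorm f g : cmeasurable f -> cmeasurable g ->
  (forall x, normc (f x) <= normc (g x)) -> (cLnorm mu p f <= cLnorm mu p g)%E.
Proof.
move=> mf mg fg; apply: le_Lnorm_EFin => //; try exact: measurable_normc.
by move=> x; rewrite normc_ge0 fg.
Qed.

Lemma cLfun_le f g : f \in cLfun mu p1 -> cmeasurable g ->
  (forall x, normc (g x) <= normc (f x)) -> g \in cLfun mu p1.
Proof.
move=> /cLfunP[mf foo] mg gf; apply/cLfunP; split => //.
by apply: le_lt_trans foo; exact: le_cLnorm.
Qed.

Lemma cmeasurable_crestrict (B : set X) f : measurable B -> cmeasurable f ->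
  cmeasurable (crestrict B f).
Proof.
move=> mB [mre mim]; split.
- rewrite (_ : (fun x => _) = (fun x => \1_B x * complex.Re (f x))).
    by apply: measurable_funM => //; exact: measurable_indic.
  apply/funext => x; rewrite /crestrict indicE.
  by case: ifP; rewrite ?mul1r ?mul0r.
- rewrite (_ : (fun x => _) = (fun x => \1_B x * complex.Im (f x))).
    by apply: measurable_funM => //; exact: measurable_indic.
  apply/funext => x; rewrite /crestrict indicE.
  by case: ifP; rewrite ?mul1r ?mul0r.
Qed.

Lemma cLfun_crestrict (B : set X) f : measurable B -> f \in cLfun mu p1 ->
  crestrict B f \in cLfun mu p1.
Proof.
move=> mB Lf; have [mf _] := cLfunP _ _ _ Lf.
apply: (cLfun_le Lf); first exact: cmeasurable_crestrict.
by move=> x; rewrite /crestrict; case: ifP => // _; rewrite normc0 normc_ge0.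
Qed.

Lemma cLnorm_crestrict (B : set X) f : measurable B ->
  cLnorm mu p (crestrict B f) =
  ((\int[mu]_(x in B) (normc (f x) `^ p)%:E) `^ p^-1)%E.
Proof.
move=> mB; rewrite cLnormE [in RHS]integral_mkcond; congr (_ `^ _)%E.
apply: eq_integral => x _; rewrite patchE /crestrict; case: ifP => // _.
by rewrite normc0 powR0 // gt_eqF.
Qed.

Lemma integrable_normc_powR f : f \in cLfun mu p1 ->
  mu.-integrable [set: X] (EFin \o (fun x => normc (f x) `^ p)).
Proof.
move=> /cLfunP[mf]; rewrite cLnormE => foo; apply/integrableP; split.
  apply/measurable_EFinP; apply: (measurableT_comp (measurable_powR _)).
  exact: measurable_normc.
have := lty_poweRy _ foo; rewrite invr_eq0 gt_eqF // => /(_ isT).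
by under [X in _ -> (X < _)%E]eq_integral do rewrite /= ger0_norm ?powR_ge0 //.
Qed.

Lemma rnorm_cLp_class f (Lf : f \in cLfun mu p1) :
  rnorm (cLp_class Lf) = fine (cLnorm mu p f).
Proof. by apply: (@complexI R); rewrite -rnormE; exact: cLp_normE. Qed.

Lemma le_rnorm_cLp_class f g (Lf : f \in cLfun mu p1) (Lg : g \in cLfun mu p1) :
  (forall x, normc (f x) <= normc (g x)) ->
  rnorm (cLp_class Lf) <= rnorm (cLp_class Lg).
Proof.
move=> fg; rewrite !rnorm_cLp_class.
have [mf _] := cLfunP _ _ _ Lf; have [mg _] := cLfunP _ _ _ Lg.
apply: fine_le; [exact: (cLnorm_fin_num (Sub f Lf : cLfunType mu p1))|
  exact: (cLnorm_fin_num (Sub g Lg : cLfunType mu p1))|exact: le_cLnorm].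
Qed.

Lemma cLp_class_sum (N : nat) (c : nat -> R[i]) (g : nat -> X -> R[i]^o)
    (Lg : forall i, g i \in cLfun mu p1) :
  exists L : (\sum_(i < N) c i *: g i) \in cLfun mu p1,
    \sum_(i < N) c i *: cLp_class (Lg i) = cLp_class L.
Proof.
have L : \sum_(i < N) c i *: g i \in cLfun mu p1.
  by apply: rpred_sum => i _; exact: rpredZ.
exists L; rewrite /cLp_class.
have -> : Sub (\sum_(i < N) c i *: g i) L =
    \sum_(i < N) c i *: (Sub (g i) (Lg i) : cLfunType mu p1).
  by apply: val_inj; rewrite raddf_sum.
rewrite raddf_sum; apply: eq_bigr => i _.
by rewrite -[LHS]/(cLp_scale _ _) cLp_scaleE.
Qed.

(** Each point lies in exactly one of the first [N] sets, so the combination multiplies [f]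
    pointwise by one of the coefficients. Bounds on their moduli thus become bounds on norms. *)
Lemma crestrict_sum (N : nat) (B : nat -> set X) (c : nat -> R[i]) f x :
  (forall i j, i != j -> B i `&` B j = set0) ->
  \bigcup_(i < N) B i = [set: X] ->
  exists i, (\sum_(i < N) c i *: crestrict (B i) f) x = c i * f x.
Proof.
move=> BB BT; have [j /= jN Bx] : (\bigcup_(i < N) B i) x by rewrite BT.
exists j; rewrite fct_sumE (bigD1 (Ordinal jN)) //= big1 ?addr0.
  by rewrite /crestrict fctE mem_set.
move=> i ij; rewrite fctE /crestrict memNset ?scaler0 // => Bix.
have : (B i `&` B j) x by []; rewrite BB //; apply: contra_neq ij.
Qed.

End Lp_restriction.

(** * Nuclear weighted conditional expectation operators *)

Lemma nuclear_zero (R : realType) (Y Z : normedModType R[i]) (T : {linear Y -> Z}) :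
  (forall y, T y = 0) -> nuclear T.
Proof.
move=> T0; have TE : (T : Y -> Z) = cst 0 by exact/funext.
split; first by rewrite TE => y; exact: cvg_cst.
exists (fun=> \0 : {linear Y -> R[i]^o}), (fun=> 0); split.
- by move=> n y; exact: cvg_cst.
- by rewrite eseries0 // => n _ _; rewrite normr0 mule0.
- move=> y; rewrite T0 (_ : series _ = cst 0); first exact: cvg_cst.
  by apply/funext => n; rewrite /series /= big1 // => i _; rewrite scaler0.
Qed.

Section vanishing.
Context d (X : measurableType d) (R : realType).
Variables (mu : {measure set X -> \bar R}) (A : set (set X)).
Hypothesis A_sigma : sigma_algebra [set: X] A.
Hypothesis A_sub : A `<=` @measurable d X.
Hypothesis A_sigma_finite : sigma_finite_sub mu A.
Hypothesis mu_sigma_finite : sigma_finite [set: X] mu.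
Hypothesis A_nonatomic : nonatomic mu A.
Variables (p q : R) (p1 : 1 <= p) (q1 : 1 <= q).
Variables (w u : X -> R[i]) (T : {linear cLp mu p1 -> cLp mu q1}).
Hypothesis T_wce : is_wce A w u T.

Lemma wce_class_crestrict (B : set X) (f : X -> R[i]^o)
    (Lf : f \in cLfun mu p1) (LfB : crestrict B f \in cLfun mu p1)
    (g := wce mu A w u f : X -> R[i]^o)
    (LgB : crestrict B g \in cLfun mu q1) :
  A B -> T (cLp_class LfB) = cLp_class LgB.
Proof.
move=> AB; have [_ _ cond Tc] := T_wce.
have [L ->] := Tc _ LfB; apply/cLp_classP.
apply: wce_crestrict => //; by have [] := cond _ Lf.
Qed.

Lemma nuclear_wce_eq0 (F : cLp mu p1) : nuclear T -> T F = 0.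
Proof.
move=> /nuclear_sign_bound[K HK]; elim/cLp_classW: F => f Lf.
have [_ _ _ Tc] := T_wce; have [Lg TE] := Tc _ Lf.
have p0 : 0 < p by exact: lt_le_trans p1.
apply: rnorm0_eq0; apply/le_anti/andP; split; last exact: rnorm_ge0.
(* Adding 1 keeps [M] positive even if [f] vanishes almost everywhere. *)
pose M := rnorm (cLp_class Lf) + 1.
have M0 : 0 < M by rewrite ltr_wpDl // rnorm_ge0.
suff small D : 0 < D -> rnorm (T (cLp_class Lf)) <= K * Num.sqrt (D * M).
  rewrite leNgt; apply/negP; set t := rnorm _ => t0.
  (* For [D = c ^+ 2 / M] the square root equals [c], and [K * c] is at most [t / 2], contradicting
     [0 < t]. *)
  pose c := t / (2 * (`|K| + 1)).
  have K0 : 0 < `|K| + 1 by rewrite ltr_wpDl.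
  have c0 : 0 < c by rewrite divr_gt0 // mulr_gt0.
  have := small (c ^+ 2 / M); rewrite divr_gt0 ?exprn_gt0 // => /(_ isT).
  rewrite divfK ?gt_eqF // sqrtr_sqr gtr0_norm // leNgt => /negP; apply.
  apply: (@le_lt_trans _ _ ((`|K| + 1) * c)).
    by rewrite ler_wpM2r ?(ltW c0) // ler_wpDr // ler_norm.
  rewrite (_ : _ * c = t / 2); last by rewrite /c; field; rewrite gt_eqF.
  by rewrite ltr_pdivrMr //; lra.
move=> D0.
have [N [B [AB Bsmall BB BT]]] := nonatomic_small_partition A_sigma A_sub
  A_sigma_finite A_nonatomic (integrable_normc_powR Lf)
  (fun x => powR_ge0 _ _) (powR_gt0 p D0).
have mB i : measurable (B i) by exact: A_sub.
pose g := wce mu A w u f : X -> R[i]^o.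
have LfB i : crestrict (B i) f \in cLfun mu p1 by exact: cLfun_crestrict.
have LgB i : crestrict (B i) g \in cLfun mu q1 by exact: cLfun_crestrict.
pose x i := cLp_class (LfB i).
have Tx i : T (x i) = cLp_class (LgB i) by exact: wce_class_crestrict.
have signE (s : nat -> bool) : T (\sum_(i < N) (if s i then - x i else x i)) =
    \sum_(i < N) (-1) ^+ s i *: cLp_class (LgB i).
  rewrite linear_sum; apply: eq_bigr => i _.
  by rewrite -scaler_sign linearZ /= Tx.
(* Since [T] acts piecewise on the [B i], signs change [g] only by a factor of modulus 1 at each
   point. *)
have Tsum (s : nat -> bool) :
    rnorm (T (\sum_(i < N) (if s i then - x i else x i))) = rnorm (cLp_class Lg).
  rewrite signE; have [L ->] := cLp_class_sum N (fun i => (-1) ^+ s i) LgB.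
  have nE y : normc ((\sum_(i < N) (-1) ^+ s i *: crestrict (B i) g) y) = normc (g y).
    have [j ->] := crestrict_sum (fun i => (-1) ^+ s i) g y BB BT.
    by rewrite normcM; case: (s j); rewrite ?expr0 ?expr1 ?normcN normc1 mul1r.
  by apply/le_anti; rewrite !le_rnorm_cLp_class // => y; rewrite nE.
have Tsum0 : rnorm (T (\sum_(i < N) x i)) = rnorm (cLp_class Lg).
  exact: (Tsum (fun=> false)).
rewrite TE -Tsum0; apply: HK => //.
- move=> i; rewrite rnorm_cLp_class cLnorm_crestrict //.
  have : ((\int[mu]_(y in B i) (normc (f y) `^ p)%:E) `^ p^-1 <= (D `^ p)%:E `^ p^-1)%E.
    apply: gt0_ler_poweR; rewrite ?invr_ge0 ?(ltW p0) //.
      rewrite in_itv /= leey andbT; apply: integral_ge0 => y _.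
      by rewrite lee_fin powR_ge0.
    by rewrite in_itv /= leey andbT lee_fin powR_ge0.
  rewrite poweR_EFin -powRrM mulfV ?gt_eqF // powRr1 ?(ltW D0) // => le.
  rewrite -lee_fin fineK // ge0_fin_numE ?poweR_ge0 //.
  exact: le_lt_trans le (ltry _).
- move=> c c1; have [L ->] := cLp_class_sum N c LfB.
  apply: le_trans (_ : rnorm (cLp_class Lf) <= _); last by rewrite ler_wpDr.
  apply: le_rnorm_cLp_class => y.
  have [j ->] := crestrict_sum c f y BB BT.
  by rewrite normcM ler_piMl ?normc_ge0.
- by move=> s; rewrite Tsum Tsum0.
Qed.

End vanishing.

Theorem corollary2p5 (R : realType) (d : measure_display)
    (X : measurableType d) (mu : {measure set X -> \bar R})
    (mu_complete : measure_is_complete mu)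
    (mu_sigma_finite : sigma_finite [set: X] mu)
    (A : set (set X)) (A_sigma : sigma_algebra [set: X] A)
    (A_sub : A `<=` @measurable d X)
    (A_sigma_finite : sigma_finite_sub mu A)
    (A_nonatomic : nonatomic mu A)
    (p q : R) (p1 : 1 <= p) (q1 : 1 <= q)
    (w u : X -> R[i]) (T : {linear cLp mu p1 -> cLp mu q1})
    (T_wce : is_wce A w u T) :
  nuclear T <-> (forall F : cLp mu p1, T F = 0).
Proof.
split=> [nucT F|T0]; last exact: nuclear_zero.
exact: (nuclear_wce_eq0 A_sigma A_sub A_sigma_finite mu_sigma_finite
  A_nonatomic T_wce).
Qed.
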